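(* Let $N\ge1$, let $\Phi_1,\ldots,\Phi_N,\Psi_1,\ldots,\Psi_N\colon\mathbb{Z}_{\ge0}\to\mathbb{C}$ be functions, and let $\beta_1,\ldots,\beta_{N-1}\in\mathbb{C}$. Then the normalizing constant of the two-dimensional distribution, $$\mathscr{Z}^{2d}_{\vec\beta}=\sum_{X^{2d}}\mathscr{W}^{2d}_{\vec\beta}(X^{2d}),$$ is equal to the one-dimensional normalizing constant $\mathscr{Z}_{\vec\beta}=\det[G_{ij}(\vec\beta)]_{i,j=1}^N$, where $G_{ij}(\vec\beta)=\sum_{k=0}^\infty\Psi_j(k)\,D_k^{[1,N)}\Phi_i(k)$. Moreover, under the normalized distribution $\mathscr{M}^{2d}_{\vec\beta}(X^{2d})=\mathscr{W}^{2d}_{\vec\beta}(X^{2d})/\mathscr{Z}_{\vec\beta}$, the marginal distribution of $x^1_1>x^2_2>\cdots>x^N_N$ coincides with the distribution of $\ell_1>\ell_2>\cdots>\ell_N$ under $\mathscr{M}_{\vec\beta}$; that is, for every finitely supported function $f$ of $N$ variables in $\mathbb{Z}_{\ge0}$, $$\sum_{X^{2d}=\{x^m_j\}}f(x^1_1,\ldots,x^N_N)\,\mathscr{M}^{2d}_{\vec\beta}(X^{2d})=\sum_{X=(\ell_1>\cdots>\ell_N\ge0)}f(\ell_1,\ldots,\ell_N)\,\mathscr{M}_{\vec\beta}(X).$$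
   Context: Operators on functions on $\mathbb{Z}_{\ge0}$, for $r=1,\ldots,N-1$: $D^{(r)}_kf(k)=f(k)-\beta_rf(k+1)$ and $D^{(r)\dagger}_kf(k)=f(k)-\beta_rf(k-1)\mathbf{1}_{k\ge1}$. Put $D^{[a,b)}_k=D^{(a)}_kD^{(a+1)}_k\cdots D^{(b-1)}_k$ and $D^{[a,b)\dagger}_k=D^{(a)\dagger}_k\cdots D^{(b-1)\dagger}_k$ (identity if $a=b$). One-dimensional ensemble ($\vec\beta$-tilted biorthogonal ensemble): for $X=(\ell_1>\ell_2>\cdots>\ell_N\ge0)$ with $\ell_j\in\mathbb{Z}$, $$\mathscr{W}_{\vec\beta}(X)=\det\bigl[D^{[1,j)}_{\ell_j}\Phi_i(\ell_j)\bigr]_{i,j=1}^N\det\bigl[D^{[j,N)\dagger}_{\ell_j}\Psi_i(\ell_j)\bigr]_{i,j=1}^N,\quad \mathscr{Z}_{\vec\beta}=\sum_X\mathscr{W}_{\vec\beta}(X),\quad \mathscr{M}_{\vec\beta}(X)=\mathscr{W}_{\vec\beta}(X)/\mathscr{Z}_{\vec\beta}.$$ Two-dimensional ensemble: configurations $X^{2d}=\{x^m_j:1\le m,j\le N\}\subset\mathbb{Z}_{\ge0}$ with $x^m_N<x^m_{N-1}<\cdots<x^m_1$ for each $m$. With $T_\beta(x,y)=\mathbf{1}_{y=x}-\beta\,\mathbf{1}_{y=x-1}$ for $x,y\in\mathbb{Z}_{\ge0}$, $$\mathscr{W}^{2d}_{\vec\beta}(X^{2d})=\det[\Phi_i(x^1_j)]_{i,j=1}^N\Bigl(\prod_{m=1}^{N-1}\det[T_{\beta_m}(x^m_i,x^{m+1}_j)]_{i,j=1}^N\Bigr)\det[\Psi_i(x^N_j)]_{i,j=1}^N.$$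 All weights may be complex. Standing assumptions: all infinite series involved converge absolutely, and $\mathscr{Z}_{\vec\beta}\neq0$. *)

(* Defs.v *)
From HB Require Import structures.
From mathcomp Require Import all_boot all_order all_algebra.
From mathcomp Require Import complex.
From mathcomp Require Import all_classical all_reals all_analysis.
From mathcomp Require summability.

Set Implicit Arguments.
Unset Strict Implicit.
Unset Printing Implicit Defensive.

Import Order.TTheory GRing.Theory Num.Theory.
Import numFieldNormedType.Exports.

Local Open Scope classical_set_scope.
Local Open Scope ring_scope.

Definition abs_summable (R : realType) (T : choiceType) (u : T -> R[i]) : Prop :=
  summable [set: T] (fun x => (ComplexField.Normc.normc (u x))%:E).

(* Limit of the sums of u over the finite subsets of T, directed by inclusion.
   R[i]^o is R[i] with the topology given by the complex modulus. *)
Definition csum (R : realType) (T : choiceType) (u : T -> R[i]) : R[i] :=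
  @summability.sum T R[i] R[i]^o u.

(* x_1 > x_2 > ... > x_N >= 0, the indices 1, ..., N being represented by the
   ordinals 0, ..., N-1 of 'I_N. *)
Definition conf (N : nat) : Type :=
  {x : {ffun 'I_N -> nat} |
    [forall i : 'I_N, forall j : 'I_N, (i < j)%N ==> (x j < x i)%N]}.
HB.instance Definition _ N := SubCountable.on (conf N).

Definition conf_pos (N : nat) (X : conf N) : {ffun 'I_N -> nat} := val X.
Coercion conf_pos : conf >-> finfun_of.

(* X m j is x^m_j: the rows x^m are strictly decreasing. *)
Definition conf2d (N : nat) : Type := {ffun 'I_N -> conf N}.
HB.instance Definition _ N := Countable.on (conf2d N).

(* (x^1_1, x^2_2, ..., x^N_N) *)
Definition diag2d (N : nat) (X : conf2d N) : {ffun 'I_N -> nat} :=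
  [ffun m => X m m].

Section Ensembles.
Variables (R : realType) (n : nat).
Local Notation N := n.+1.
Variables (Phi Psi : 'I_N -> nat -> R[i]) (beta : 'I_n -> R[i]).

Definition Dop (b : R[i]) (f : nat -> R[i]) : nat -> R[i] :=
  fun k => f k - b * f k.+1.

Definition Ddag (b : R[i]) (f : nat -> R[i]) : nat -> R[i] :=
  fun k => f k - b * f k.-1 * (1 <= k)%N%:R.

(* With one-based beta_1, ..., beta_{N-1}, the entry beta_r is [beta (r-1)], so
   D^{[a,b)} is [Dint (a-1) (b-1)] for 1 <= a <= b <= N; same for [Ddagint]. *)
Definition Dint (a b : nat) : (nat -> R[i]) -> (nat -> R[i]) :=
  \big[(fun F G => F \o G)/id]_(r < n | (a <= r < b)%N) Dop (beta r).

Definition Ddagint (a b : nat) : (nat -> R[i]) -> (nat -> R[i]) :=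
  \big[(fun F G => F \o G)/id]_(r < n | (a <= r < b)%N) Ddag (beta r).

Definition weight1d (X : conf N) : R[i] :=
  \det (\matrix_(i < N, j < N) Dint 0 j (Phi i) (X j)) *
  \det (\matrix_(i < N, j < N) Ddagint j n (Psi i) (X j)).

Definition Z1d : R[i] := csum weight1d.

Definition M1d (X : conf N) : R[i] := weight1d X / Z1d.

(* The second indicator is written y + 1 = x because nat subtraction would
   identify 0 - 1 with 0. *)
Definition Tker (b : R[i]) (x y : nat) : R[i] :=
  (y == x)%:R - b * (y.+1 == x)%:R.

(* [widen_ord (leqnSn n) m] and [lift ord0 m] have values m and m + 1. *)
Definition weight2d (X : conf2d N) : R[i] :=
  \det (\matrix_(i < N, j < N) Phi i (X ord0 j)) *
  (\prod_(m < n) \det (\matrix_(i < N, j < N)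
     Tker (beta m) (X (widen_ord (leqnSn n) m) i) (X (lift ord0 m) j))) *
  \det (\matrix_(i < N, j < N) Psi i (X ord_max j)).

Definition Z2d : R[i] := csum weight2d.

Definition M2d (X : conf2d N) : R[i] := weight2d X / Z1d.

Definition Gterm (i j : 'I_N) (k : nat) : R[i] := Psi j k * Dint 0 n (Phi i) k.

Definition Gmx : 'M[R[i]]_N :=
  \matrix_(i < N, j < N) limn (series (Gterm i j : nat -> R[i]^o)).

End Ensembles.

(* Main.v *)
(* A determinant of T between strictly decreasing rows equals the product of its
   diagonal, so a two-dimensional configuration of nonzero weight is an array whose
   columns go down by 0 or 1 at each step and whose rows are strictly decreasing.
   Fix one anchor entry in each column, in row a(j) of column j, with a nondecreasing
   and of increments at most 1, and sum over the other entries. Without the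
   constraint on the rows the columns are independent and, by multilinearity, the sum
   is det[D^{[0,a(j))} Phi_i(l_j)] det[D^{dagger [a(j),n)} Psi_i(l_j)]. The arrays
   violating the constraint contribute 0: two adjacent columns must meet, in a row
   that lies weakly above both anchors or weakly below both, and exchanging the two
   columns beyond the meeting point changes the sign of det Phi or of det Psi.
   For a(j) = j this is the one-dimensional weight; for a(j) = n it is
   det[D^{[0,n)} Phi_i(l_j)] det[Psi_i(l_j)], which sums to det G by Cauchy-Binet. *)
Require Import Defs.
From mathcomp Require Import all_boot all_order all_algebra.
From mathcomp Require Import complex.
From mathcomp Require Import all_classical all_reals all_analysis.
From mathcomp Require Import fingroup perm finmap zify ring.
From mathcomp Require summability.

Set Implicit Arguments.
Unset Strict Implicit.
Unset Printing Implicit Defensive.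
Import Order.TTheory GRing.Theory Num.Theory.
Import numFieldNormedType.Exports.
Local Open Scope classical_set_scope.
Local Open Scope ring_scope.

(** * Determinants *)

(** A strictly increasing permutation [t] satisfies [i <= t i]; applied to [s] and to its inverse,
    this gives both inequalities. *)
Lemma increasing_perm1 (n : nat) (s : 'S_n) :
  (forall i j : 'I_n, (i < j)%N -> (s i < s j)%N) -> s = 1%g.
Proof.
have le_incr (t : 'S_n) (i : 'I_n) :
    (forall i j : 'I_n, (i < j)%N -> (t i < t j)%N) -> (i <= t i)%N.
  move=> tP; case: i => i; elim: i => // i IH lt_i1_n.
  have lt_in := ltnW lt_i1_n.
  exact: leq_ltn_trans (IH lt_in) (tP (Ordinal lt_in) (Ordinal lt_i1_n) _).
move=> sP; apply/permP => i; rewrite perm1; apply/val_inj/eqP.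
rewrite eqn_leq le_incr// andbT -[leqRHS]/(val i) -{2}(permK s i).
apply: le_incr => j k jk; rewrite ltnNge; apply/negP => le_kj.
have : (s ((s^-1)%g k) <= s ((s^-1)%g j))%N.
  by move: le_kj; rewrite leq_eqVlt => /predU1P[/val_inj->//|/sP/ltnW].
by rewrite !permKV leqNgt jk.
Qed.

Section DetColumns.
Variables (C : comNzRingType) (n : nat).

Lemma det_columns (f : 'I_n -> 'I_n -> C) :
  \det (\matrix_(i, j) f i j) = \sum_(s : 'S_n) (-1) ^+ s * \prod_j f (s j) j.
Proof.
rewrite -det_tr; apply: eq_bigr => s _; congr (_ * _).
by apply: eq_bigr => j _; rewrite !mxE.
Qed.

Lemma det_comp_perm (T : Type) (f : 'I_n -> T -> C) (x : 'I_n -> T) (s : 'S_n) :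
  \det (\matrix_(i, j) f i (x (s j))) =
  (-1) ^+ s * \det (\matrix_(i, j) f i (x j)).
Proof.
have -> : \matrix_(i, j) f i (x (s j)) =
    col_perm s (\matrix_(i, j) f i (x j)).
  by apply/matrixP => i j; rewrite !mxE.
by rewrite col_permE det_mulmx det_perm odd_permV mulrC.
Qed.

Lemma det_eq_columns (T : Type) (f : 'I_n -> T -> C) (x : 'I_n -> T) i j :
  i != j -> x i = x j -> \det (\matrix_(i, j) f i (x j)) = 0.
Proof.
move=> ij xij; rewrite -det_tr; apply: (determinant_alternate ij) => k.
by rewrite !mxE xij.
Qed.

(** Once both determinants are expanded over permutations, the summand is a product over the
    columns, so the sum over [e] factors into one sum per column. *)
Lemma sum_prod_det_det (E : finType) (f g : 'I_n -> 'I_n -> E -> C)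
    (b : 'I_n -> E -> C) :
  \sum_(e : {ffun 'I_n -> E}) (\prod_j b j (e j)) *
     \det (\matrix_(i, j) f i j (e j)) * \det (\matrix_(i, j) g i j (e j)) =
  \sum_(s : 'S_n) \sum_(t : 'S_n) (-1) ^+ s * (-1) ^+ t *
    \prod_j \sum_e b j e * f (s j) j e * g (t j) j e.
Proof.
have comm (p q r u v : C) : p * (u * q * (v * r)) = u * v * (p * q * r) by ring.
under eq_bigr => e _ do rewrite !det_columns -mulrA big_distrlr mulr_sumr /=.
rewrite exchange_big; apply: eq_bigr => s _ /=.
under eq_bigr => e _ do rewrite mulr_sumr.
rewrite exchange_big; apply: eq_bigr => t _ /=.
rewrite bigA_distr_bigA mulr_sumr; apply: eq_bigr => e _ /=.
by rewrite !big_split/=; exact: comm.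
Qed.

End DetColumns.

(** * Finite Cauchy-Binet formula *)

Section CauchyBinet.
Variables (n K : nat).

Definition strict_dec (y : {ffun 'I_n -> 'I_K}) : bool :=
  [forall i : 'I_n, forall j : 'I_n, (i < j)%N ==> (y j < y i)%N].

Lemma strict_decP (y : {ffun 'I_n -> 'I_K}) :
  reflect (forall i j : 'I_n, (i < j)%N -> (y j < y i)%N) (strict_dec y).
Proof.
apply: (iffP forallP) => yP i; last by apply/forallP => j; exact/implyP/yP.
by move=> j; have /forallP/(_ j)/implyP := yP i.
Qed.

Lemma strict_dec_inj (y : {ffun 'I_n -> 'I_K}) : strict_dec y -> injective y.
Proof.
move=> /strict_decP yP i j yij; apply/val_inj/eqP; rewrite eqn_leq.
rewrite leqNgt [X in _ && X]leqNgt.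
by apply/andP; split; apply/negP => /yP; rewrite yij ltnn.
Qed.

Lemma sort_injective (f : {ffun 'I_n -> 'I_K}) : injective f ->
  exists2 y : {ffun 'I_n -> 'I_K}, strict_dec y &
    exists s : 'S_n, f = [ffun i => y (s i)].
Proof.
move=> f_inj; pose le i j := (f j <= f i)%N.
pose s := sort le (enum 'I_n).
have s_size : size s = n by rewrite size_sort size_enum_ord.
have s_uniq : uniq s by rewrite sort_uniq enum_uniq.
have s_sorted : sorted le s by apply: sort_sorted => i j; exact: leq_total.
pose t (i : 'I_n) := nth i s i.
have tE (x i : 'I_n) : t i = nth x s i by apply: set_nth_default; rewrite s_size.
have t_inj : injective t.
  move=> i j /eqP; rewrite (tE i j) nth_uniq ?s_size// => /eqP; exact: val_inj.
exists [ffun i => f (t i)].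
  apply/strict_decP => i j ij; rewrite !ffunE ltn_neqAle.
  apply/andP; split.
    by apply: contraTneq ij => /val_inj/f_inj/t_inj ->; rewrite ltnn.
  rewrite (tE i j); apply: (sorted_leq_nth _ _ i s_sorted);
    rewrite ?inE ?s_size//; last exact: ltnW.
  - by move=> x y z xy yz; exact: leq_trans yz xy.
  - by move=> x; exact: leqnn.
exists (perm t_inj)^-1%g; apply/ffunP => i; rewrite !ffunE.
by rewrite -[in RHS](permE t_inj) permKV.
Qed.

(** An injective map is a strictly decreasing one precomposed with a permutation, in a unique way:
    existence by sorting, uniqueness because an increasing permutation is the identity. *)
Lemma sum_injective (R : nmodType) (g : {ffun 'I_n -> 'I_K} -> R) :
  (forall f : {ffun _}, ~~ injectiveb f -> g f = 0) ->
  \sum_f g f = \sum_(y | strict_dec y) \sum_(s : 'S_n) g [ffun i => y (s i)].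
Proof.
move=> g0; rewrite (bigID (fun f : {ffun 'I_n -> 'I_K} => injectiveb f))/=.
rewrite [X in _ + X]big1 ?addr0; last exact: g0.
rewrite pair_big_dep/=.
pose h (p : {ffun 'I_n -> 'I_K} * 'S_n) : {ffun 'I_n -> 'I_K} :=
  [ffun i => p.1 (p.2 i)].
have h_inj : {in [pred p | strict_dec p.1] &, injective h}.
  move=> [y s] [y' s']; rewrite !inE/= => yP y'P /ffunP eqh.
  have eqy i : y i = y' ((s^-1 * s')%g i).
    by have := eqh ((s^-1)%g i); rewrite !ffunE/= permKV permM.
  have s1 : (s^-1 * s' = 1)%g.
    apply: increasing_perm1 => i j ij; rewrite ltnNge; apply/negP => le_ji.
    have /strict_decP/(_ _ _ ij) := yP; rewrite !eqy ltnNge => /negP; apply.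
    move: le_ji; rewrite leq_eqVlt => /predU1P[/val_inj->//|].
    by move=> /(strict_decP _ y'P)/ltnW.
  have -> : s' = s by rewrite -[s']mul1g -(mulgV s) -mulgA s1 mulg1.
  by congr (_, _); apply/ffunP => i; rewrite eqy s1 perm1.
rewrite (eq_bigl [pred p : {ffun 'I_n -> 'I_K} * 'S_n | strict_dec p.1]); last first.
  by move=> p; rewrite /= andbT.
rewrite -[RHS](big_imset g h_inj); apply: eq_bigl => f.
apply/injectiveP/imsetP => [/sort_injective[y yP [s ->]]|].
  by exists (y, s).
move=> [[y s]]; rewrite inE/= => yP -> i j; rewrite !ffunE.
by move=> /(strict_dec_inj yP)/perm_inj.
Qed.

Lemma Cauchy_Binet (C : comNzRingType) (A B : 'I_n -> 'I_K -> C) :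
  \sum_(y : {ffun 'I_n -> 'I_K} | strict_dec y)
    \det (\matrix_(i, j) A i (y j)) * \det (\matrix_(i, j) B i (y j)) =
  \det (\matrix_(i, j) \sum_k A i k * B j k).
Proof.
(* Both sides equal the sum of [g] over all maps: the right one by multilinearity, the left one by
   grouping injective maps by their sorted values. *)
pose g (f : {ffun 'I_n -> 'I_K}) :=
  (\prod_i A i (f i)) * \det (\matrix_(i, j) B i (f j)).
transitivity (\sum_f g f); last first.
  rewrite /determinant (eq_bigr (fun f : {ffun 'I_n -> 'I_K} => \sum_(s : 'S_n)
     (-1) ^+ s * \prod_j (A j (f j) * B (s j) (f j)))); last first.
    move=> f _; rewrite /g det_columns mulr_sumr; apply: eq_bigr => s _.
    by rewrite mulrCA -big_split.
  rewrite exchange_big; apply: eq_bigr => s _ /=.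
  rewrite -mulr_sumr; congr (_ * _).
  under [RHS]eq_bigr => i _ do rewrite mxE.
  by rewrite bigA_distr_bigA.
rewrite sum_injective; last first.
  move=> f /injectivePn[i [j ij fij]].
  by rewrite /g (det_eq_columns _ ij fij) mulr0.
apply: eq_bigr => y _; rewrite {1}/determinant mulr_suml.
apply: eq_bigr => s _; rewrite /g.
have -> : \matrix_(i, j) B i ([ffun i0 => y (s i0)] j) =
   \matrix_(i, j) B i (y (s j)) by apply/matrixP => i j; rewrite !mxE ffunE.
rewrite det_comp_perm mulrA; congr (_ * _); rewrite mulrC; congr (_ * _).
by apply: eq_bigr => i _; rewrite mxE ffunE.
Qed.

End CauchyBinet.

(** * Shift operators *)

Section ShiftOperators.
Variable C : comNzRingType.

(** On the integers, D ([d = 1]) and its adjoint ([d = -1]) share one form, with [c] equal to minus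
    beta and no boundary term. *)
Definition shift_op (c : C) (d : int) (f : int -> C) : int -> C :=
  fun k => f k + c * f (k + d).

Definition shift_ops (n : nat) (P : pred 'I_n) (c : 'I_n -> C) (d : int) :
    (int -> C) -> int -> C :=
  \big[(fun F G => F \o G)/id]_(r < n | P r) shift_op (c r) d.

Lemma shift_opsS (n : nat) (P : pred 'I_n.+1) (c : 'I_n.+1 -> C) d f k :
  shift_ops P c d f k =
  shift_ops (P \o lift ord0) (c \o lift ord0) d f k +
  (if P ord0 then c ord0 * shift_ops (P \o lift ord0) (c \o lift ord0) d f (k + d)
   else 0).
Proof.
have indexE m : index_enum 'I_m = enum 'I_m by rewrite enumT /index_enum unlock.
rewrite /shift_ops !indexE enum_ordSl big_cons big_map.
by case: (P ord0) => /=; rewrite ?addr0.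
Qed.

Lemma sum_ffunS (I : finType) (n : nat) (F : {ffun 'I_n.+1 -> I} -> C) :
  \sum_e F e =
  \sum_x \sum_(e : {ffun 'I_n -> I})
    F [ffun i => if unlift ord0 i is Some j then e j else x].
Proof.
rewrite pair_big/=.
pose h (p : I * {ffun 'I_n -> I}) : {ffun 'I_n.+1 -> I} :=
  [ffun i => if unlift ord0 i is Some j then p.2 j else p.1].
pose h' (e : {ffun 'I_n.+1 -> I}) : I * {ffun 'I_n -> I} :=
  (e ord0, [ffun i => e (lift ord0 i)]).
rewrite (reindex h)//; exists h' => [[x e] _|e _]; rewrite /h /h'/=.
  congr (_, _); rewrite ?ffunE ?unlift_none//.
  by apply/ffunP => i; rewrite !ffunE liftK.
by apply/ffunP => i; rewrite !ffunE; case: unliftP => [j ->|->]; rewrite ?ffunE.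
Qed.

(** [e r] records whether factor [r] contributes its shift or its identity. Each [r] lies in exactly
    one of [P] and [predC P], so a single [e] expands both products. *)
Lemma shift_ops_expand (n : nat) (P : pred 'I_n) (c : 'I_n -> C)
    (f g : int -> C) (k l : int) :
  \sum_(e : {ffun 'I_n -> bool}) (\prod_r c r ^+ e r) *
    f (k + \sum_(r | P r) (e r)%:Z) * g (l - \sum_(r | ~~ P r) (e r)%:Z) =
  shift_ops P c 1 f k * shift_ops (predC P) c (- 1) g l.
Proof.
elim: n => [|n IH] in P c f g k l *.
  rewrite (big_pred1 [ffun _ => false]); last by move=> e; apply/esym/eqP/ffunP; case.
  by rewrite !big_ord0/= /shift_ops !big_ord0 mul1r addr0 subr0.
pose c' := c \o lift ord0.
rewrite sum_ffunS big_bool/= !shift_opsS/=.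
have sumE (Q : pred 'I_n.+1) (x : bool) (e : {ffun 'I_n -> bool}) :
    \sum_(r | Q r)
      ([ffun i => if unlift ord0 i is Some j then e j else x] r)%:Z =
    (Q ord0 && x)%:Z + \sum_(r | Q (lift ord0 r)) (e r)%:Z.
  rewrite big_mkcond big_ord_recl/= -big_mkcond/= ffunE unlift_none.
  congr (_ + _); first by case: (Q ord0).
  by apply: eq_bigr => r _; rewrite ffunE liftK.
have prodE (x : bool) (e : {ffun 'I_n -> bool}) :
    \prod_r c r ^+ [ffun i => if unlift ord0 i is Some j then e j else x] r =
    c ord0 ^+ x * \prod_r c' r ^+ e r.
  rewrite big_ord_recl ffunE unlift_none; congr (_ * _).
  by apply: eq_bigr => r _; rewrite ffunE liftK.
under eq_bigr => e _ do rewrite prodE 2!sumE andbT andbT expr1 -!mulrA.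
under [X in _ + X]eq_bigr => e _ do
  rewrite prodE 2!sumE andbF andbF expr0 mul1r !add0r.
rewrite IH -mulr_sumr.
under eq_bigr => e _ do rewrite mulrA addrA opprD addrA.
rewrite IH; case: (P ord0) => /=; rewrite ?subr0 ?addr0; ring.
Qed.

Lemma shift_ops_up_ge0 (n : nat) (P : pred 'I_n) (c : 'I_n -> C)
    (op : 'I_n -> (nat -> C) -> nat -> C) (f : nat -> C) (F : int -> C) :
  (forall r g k, op r g k = g k + c r * g k.+1) ->
  (forall k : nat, F k%:Z = f k) -> forall k : nat,
  shift_ops P c 1 F k%:Z = (\big[(fun F G => F \o G)/id]_(r < n | P r) op r) f k.
Proof.
move=> opE Ff; rewrite /shift_ops.
elim/big_rec2: _ => //= r G H _ IH k; rewrite opE /shift_op IH.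
by rewrite -(IH k.+1) -addn1 PoszD.
Qed.

(** Downward shifts preserve vanishing on negative arguments, which at [k = 0] plays the part of the
    indicator of [1 <= k]. *)
Lemma shift_ops_down_ge0 (n : nat) (P : pred 'I_n) (c : 'I_n -> C)
    (op : 'I_n -> (nat -> C) -> nat -> C) (f : nat -> C) (F : int -> C) :
  (forall r g k, op r g k = g k + c r * g k.-1 * (1 <= k)%N%:R) ->
  (forall k : nat, F k%:Z = f k) -> (forall k : int, k < 0 -> F k = 0) ->
  forall k : nat,
  shift_ops P c (- 1) F k%:Z = (\big[(fun F G => F \o G)/id]_(r < n | P r) op r) f k.
Proof.
move=> opE Ff F0; rewrite /shift_ops.
set G := (X in X F); set H := (X in X f).
suff : (forall k : nat, G F k%:Z = H f k) /\ (forall k : int, k < 0 -> G F k = 0).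
  by case.
rewrite /G /H {G H}; elim/big_rec2: _ => [//|/= r G H _ [IH1 IH2]]; split.
  case=> [|k]; rewrite opE /shift_op -!IH1.
    by rewrite [X in _ + _ * X = _]IH2 ?mulr0.
  by rewrite mulr1; congr (_ + _ * _); congr (_ _); lia.
by move=> k k0; rewrite /shift_op !IH2 ?mulr0 ?addr0//; lia.
Qed.

End ShiftOperators.

(** * Arrays with columns decreasing by 0 or 1 *)

Section Arrays.
Variables (n : nat) (a : 'I_n.+1 -> nat) (l : 'I_n.+1 -> nat).
Local Notation N := n.+1.
Local Notation array := {ffun 'I_N -> {ffun 'I_n -> bool}}.

(* [e j r] tells whether column j decreases by 1, rather than by 0, from row r to
   row r + 1, rows being numbered from 0 to n; [descent e u v j] is then
   x^u_j - x^v_j, for either order of u and v. *)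
Definition descent (e : array) (u v : nat) (j : 'I_N) : int :=
  \sum_(r < n) (e j r)%:Z * ((u <= r)%N%:Z - (v <= r)%N%:Z).

(* The entry of row m in column j of the array which has entry [l j] in row [a j]. *)
Definition pos (e : array) (m : nat) (j : 'I_N) : int := (l j)%:Z + descent e m (a j) j.

Lemma descentD e u v w j : descent e u w j = descent e u v j + descent e v w j.
Proof.
by rewrite /descent -big_split; apply: eq_bigr => r _ /=; ring.
Qed.

Lemma descent_id e u j : descent e u u j = 0.
Proof. by rewrite /descent big1// => r _; rewrite subrr mulr0. Qed.

Lemma descent_step e (m : 'I_n) j : descent e m m.+1 j = (e j m)%:Z.
Proof.
rewrite /descent (bigD1 m)//= leqnn ltnn subr0 mulr1 big1 ?addr0// => r rm.
have -> : (m <= r)%N = (m < r)%N by rewrite leq_eqVlt eq_sym [_ == _ :> nat](negbTE rm).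
by rewrite subrr mulr0.
Qed.

Lemma pos_step e (m : 'I_n) j : pos e m j = pos e m.+1 j + (e j m)%:Z.
Proof. by rewrite /pos (descentD e m m.+1) descent_step; lia. Qed.

Lemma pos_anchor e j : pos e (a j) j = l j.
Proof. by rewrite /pos descent_id addr0. Qed.

Definition lcol (k : 'I_n) : 'I_N := widen_ord (leqnSn n) k.
Definition rcol (k : 'I_n) : 'I_N := lift ord0 k.

Hypothesis a_le : forall j, (a j <= n)%N.
Hypothesis a_mono : forall i j : 'I_N, (i <= j)%N -> (a i <= a j)%N.
Hypothesis a_step : forall k : 'I_n, (a (rcol k) <= (a (lcol k)).+1)%N.
Hypothesis l_dec : forall i j : 'I_N, (i < j)%N -> (l j < l i)%N.

Lemma anchor_mono k : (a (lcol k) <= a (rcol k))%N.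
Proof. exact/a_mono/leqnSn. Qed.

Lemma lcol_neq_rcol k : lcol k != rcol k.
Proof. by rewrite -val_eqE neq_ltn ltnSn. Qed.

(** * Ties of adjacent columns and the swap at a tie *)

Definition place : Type := ('I_N * 'I_n)%type.

Definition tie (e : array) (p : place) : bool :=
  pos e p.1 (lcol p.2) == pos e p.1 (rcol p.2).

(** The right anchor is in the row of the left one or in the next row. Hence [p] is weakly above
    both anchors if this holds and weakly below both otherwise. *)
Definition above (p : place) : bool := (p.1 <= a (lcol p.2))%N.

(* Swapping at a tie p changes no entry that is involved in a place of rank at most
   [rank p], so that the choice of a tie of minimal rank is stable under the swap. *)
Definition rank (p : place) : nat := if above p then (n - p.1)%N else (N + p.1)%N.

Definition outer (p : place) (r : nat) : bool :=
  if above p then (r <= p.1)%N else (p.1 <= r)%N.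
Definition inner (p : place) (r : nat) : bool :=
  if above p then (p.1 <= r)%N else (r <= p.1)%N.

Definition pswap (p : place) : 'S_N := tperm (lcol p.2) (rcol p.2).

(** Step [r] joins rows [r] and [r + 1], and both must be outer: hence the strict inequality in one
    case only. *)
Definition outer_step (p : place) (r : nat) : bool :=
  if above p then (r < p.1)%N else (p.1 <= r)%N.

(* Exchanges the parts of the two columns of p which lie beyond p when seen from the
   anchors. *)
Definition swap (p : place) (e : array) : array :=
  [ffun j : 'I_N => [ffun r : 'I_n => e (if outer_step p r then pswap p j else j) r]].

Lemma swapK p : involutive (swap p).
Proof.
move=> e; apply/ffunP => j; apply/ffunP => r; rewrite !ffunE.
by case: outer_step => //; rewrite /pswap tpermK.
Qed.

(** Both exchanged columns have their anchors on the inner side, so the swap keeps the anchored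
    entries. *)
Lemma pswap_moved_inner p j : pswap p j != j -> inner p (a j).
Proof.
rewrite /pswap /inner; have := a_step p.2; have := anchor_mono p.2.
by rewrite /above; case: tpermP => [->|->|]; rewrite ?eqxx// => h1 h2 _;
  case: ifP => h; lia.
Qed.

Lemma descent_swap_inner p e u v j : inner p u -> inner p v ->
  descent (swap p e) u v j = descent e u v j.
Proof.
move=> pu pv; apply: eq_bigr => r _; rewrite !ffunE; move: pu pv.
rewrite /inner /outer_step; case: above => h1 h2; case: ifP => // h.
all: suff -> : (u <= r)%N = (v <= r)%N by rewrite subrr !mulr0.
all: by lia.
Qed.

Lemma descent_swap_outer p e u v j : outer p u -> outer p v ->
  descent (swap p e) u v j = descent e u v (pswap p j).
Proof.
move=> pu pv; apply: eq_bigr => r _; rewrite !ffunE; move: pu pv.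
rewrite /outer /outer_step; case: above => h1 h2; case: ifP => // h.
all: suff -> : (u <= r)%N = (v <= r)%N by rewrite subrr !mulr0.
all: by lia.
Qed.

Lemma swap_fixed p e j : pswap p j = j -> swap p e j = e j.
Proof. by move=> pj; apply/ffunP => r; rewrite !ffunE pj; case: ifP. Qed.

Lemma pos_swap_fixed p e m j : pswap p j = j -> pos (swap p e) m j = pos e m j.
Proof. by move=> pj; rewrite /pos /descent swap_fixed. Qed.

Lemma pos_swap_inner p e m j : inner p m -> pos (swap p e) m j = pos e m j.
Proof.
move=> pm; have [/eqP pj|pj] := boolP (pswap p j == j); first exact: pos_swap_fixed.
by rewrite /pos descent_swap_inner// pswap_moved_inner.
Qed.

Lemma outer_self p : outer p p.1. Proof. by rewrite /outer; case: above. Qed.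
Lemma inner_self p : inner p p.1. Proof. by rewrite /inner; case: above. Qed.

Lemma pos_descent e m m' j : pos e m j = pos e m' j + descent e m m' j.
Proof. by rewrite /pos (descentD e m m'); ring. Qed.

(** The two columns agree in the row of [p]; beyond it they exchange their steps, hence their
    entries. *)
Lemma pos_swap_outer p e m j : tie e p -> outer p m ->
  pos (swap p e) m j = pos e m (pswap p j).
Proof.
move=> /eqP tp pm; rewrite (pos_descent _ _ p.1) pos_swap_inner ?inner_self//.
rewrite descent_swap_outer ?outer_self// [RHS](pos_descent _ _ p.1); congr (_ + _).
by rewrite /pswap; case: tpermP => [->|->|//]; rewrite tp.
Qed.

Lemma tie_swap p e q : (rank q <= rank p)%N -> tie (swap p e) q = tie e q.
Proof.
move=> qp; suff posE j : j = lcol q.2 \/ j = rcol q.2 ->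
    pos (swap p e) q.1 j = pos e q.1 j by rewrite /tie !posE//; [right|left].
move=> jq; have [/eqP pj|pj] := boolP (pswap p j == j); first exact: pos_swap_fixed.
apply: pos_swap_inner; move: qp (pswap_moved_inner pj); rewrite /rank /inner.
have := ltn_ord q.1; have := ltn_ord p.1.
case: ifP => aq; case: ifP => // ap h1 h2; try lia.
(* Remaining case: [q] is above its anchors and [p] is not, so [q.1] is at most [a j], which is at
   most [p.1]. *)
move=> _; apply: leq_trans.
move: aq; rewrite /above => /leq_trans; apply.
by case: jq => ->; rewrite ?anchor_mono.
Qed.

Definition first_tie (e : array) (p : place) : bool :=
  tie e p && [forall q, tie e q ==> (rank p <= rank q)%N].

Lemma first_tie_swap_self p e : first_tie e p -> first_tie (swap p e) p.
Proof.
move=> /andP[tp /forallP minp]; rewrite /first_tie tie_swap// tp/=.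
apply/forallP => q; apply/implyP => tq; rewrite leqNgt; apply/negP => lt_qp.
move: tq; rewrite tie_swap; last exact: ltnW.
by move=> tq; have := minp q; rewrite tq/= leqNgt lt_qp.
Qed.

Lemma first_tie_swap p e q : first_tie e p -> first_tie e q -> first_tie (swap p e) q.
Proof.
move=> ep /andP[tq /forallP minq]; have /andP[tp /forallP minp] := ep.
have /andP[_ /forallP minp'] := first_tie_swap_self ep.
have rq : rank q = rank p.
  by apply/eqP; rewrite eqn_leq (implyP (minq p) tp) (implyP (minp q) tq).
rewrite /first_tie tie_swap ?rq// tq/=.
by apply/forallP => q'; apply/implyP => /(implyP (minp' q')).
Qed.

(** Several places may share the least rank. A swap at one of them preserves the whole set of first
    ties, so [pick] returns the same place before and after. *)
Definition tie_key (e : array) : option place := [pick p | first_tie e p].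

Lemma tie_key_swap p e : tie_key e = Some p -> tie_key (swap p e) = Some p.
Proof.
rewrite /tie_key => ep; rewrite -ep; apply: eq_pick => q /=.
move: ep; case: pickP => // p' ep [<-]; apply/idP/idP; last exact: first_tie_swap.
by move=> /(first_tie_swap (first_tie_swap_self ep)); rewrite swapK.
Qed.

Lemma tie_key_tie e p : tie_key e = Some p -> tie e p.
Proof. by rewrite /tie_key; case: pickP => // p' /andP[tp _] [<-]. Qed.

Lemma tie_key_none e : tie_key e = None -> forall p, ~~ tie e p.
Proof.
rewrite /tie_key; case: pickP => // no_first _ p; apply/negP => tp.
have [q tq minq] := arg_minnP rank tp.
have := no_first q; rewrite /first_tie tq/= => /negP; apply.
by apply/forallP => q'; apply/implyP; exact: minq.
Qed.

Lemma no_tie_dec e (m : nat) : (forall p, ~~ tie e p) -> (m <= n)%N ->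
  forall i j : 'I_N, (i < j)%N -> pos e m j < pos e m i.
Proof.
move=> noTie mn.
have bool_le (b : bool) : (b : nat)%:Z = 0 \/ (b : nat)%:Z = 1 by case: b; [right|left].
have adj (k : 'I_n) : forall m : nat, (m <= n)%N -> pos e m (rcol k) < pos e m (lcol k).
  (* d moves by at most 1 between consecutive rows, so without a zero it keeps the
     sign that it has at the anchor of column k. *)
  pose d m := pos e m (lcol k) - pos e m (rcol k).
  have d_neq0 i : (i <= n)%N -> d i <> 0.
    move=> lt_in /eqP; rewrite subr_eq0 => tp.
    by have := noTie (Ordinal (n := N) (m := i) lt_in, k); rewrite /tie/= tp.
  have d_step i : (i < n)%N -> (0 < d i) = (0 < d i.+1).
    move=> lt_in; have := d_neq0 i (ltnW lt_in); have := d_neq0 i.+1 lt_in.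
    rewrite /d; have := pos_step e (Ordinal lt_in) (lcol k).
    have := pos_step e (Ordinal lt_in) (rcol k) => /=.
    by case: (bool_le (e (lcol k) (Ordinal lt_in)));
      case: (bool_le (e (rcol k) (Ordinal lt_in))); lia.
  have d_const i : (i <= n)%N -> (0 < d 0%N) = (0 < d i).
    elim: i => [//|i IH lt_in]; rewrite (IH (ltnW lt_in)); exact: d_step.
  suff d_pos : 0 < d (a (lcol k)).
    by move=> i le_in; rewrite -subr_gt0 -/(d i) -d_const// (d_const (a (lcol k))).
  have := d_neq0 _ (a_le (lcol k)); rewrite /d pos_anchor.
  have : (l (rcol k) < l (lcol k))%N by exact/l_dec/ltnSn.
  (* If the right anchor is one row lower, the step up from it adds at most 1 to an entry smaller
     than [l (lcol k)]; so [d] is nonnegative at the left anchor, and it is not 0. *)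
  have := a_step k; rewrite leq_eqVlt => /predU1P[ar|ar].
    have lt_an : (a (lcol k) < n)%N by have := a_le (rcol k); rewrite ar.
    have := pos_step e (Ordinal lt_an) (rcol k) => /=; rewrite -ar pos_anchor.
    by case: (bool_le (e (rcol k) (Ordinal lt_an))); lia.
  have -> : a (lcol k) = a (rcol k) by have := anchor_mono k; lia.
  by rewrite pos_anchor; lia.
move=> [i lt_iN] [j lt_jN] /= lt_ij.
elim: j => // j IH in lt_jN lt_ij *.
have lt_jn : (j < n)%N by [].
have := adj (Ordinal lt_jn) m mn.
have -> : rcol (Ordinal lt_jn) = Ordinal lt_jN by apply: val_inj.
have -> : lcol (Ordinal lt_jn) = Ordinal (ltnW lt_jN) by apply: val_inj.
move: lt_ij; rewrite ltnS leq_eqVlt => /predU1P[ij|lt_ij].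
  by have -> : Ordinal (ltnW lt_jN) = Ordinal lt_iN by apply: val_inj.
by move=> /lt_trans; apply; exact: IH.
Qed.

(** * Cancellation of the arrays with a tie *)

Section Cancellation.
Variables (C : numDomainType) (c : 'I_n -> C) (F G : ('I_N -> int) -> C).
Hypothesis F_ext : forall x y, x =1 y -> F x = F y.
Hypothesis G_ext : forall x y, x =1 y -> G x = G y.
Hypothesis F_alt : forall x i j, i != j -> F (x \o tperm i j) = - F x.
Hypothesis G_alt : forall x i j, i != j -> G (x \o tperm i j) = - G x.

Definition array_weight (e : array) : C :=
  (\prod_j \prod_r c r ^+ e j r) * F (pos e 0) * G (pos e n).

(** Row 0 is outer and row [n] inner, or conversely, so exactly one of [F] and [G] changes sign. The
    product is unchanged because [c r] does not depend on the column. *)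
Lemma array_weight_swap p e : tie e p ->
  array_weight (swap p e) = - array_weight e.
Proof.
move=> tp; rewrite /array_weight.
have -> : \prod_j \prod_r c r ^+ swap p e j r = \prod_j \prod_r c r ^+ e j r.
  rewrite exchange_big [RHS]exchange_big/=; apply: eq_bigr => r _.
  under eq_bigr => j _ do rewrite !ffunE.
  case: outer_step => //.
  by rewrite [RHS](reindex_inj (@perm_inj _ (pswap p))).
have le_pn : (p.1 <= n)%N by rewrite -ltnS.
have [ap|ap] := boolP (above p).
  rewrite (F_ext (y := pos e 0 \o pswap p)); last first.
    by move=> j; rewrite pos_swap_outer// /outer ap.
  rewrite F_alt ?lcol_neq_rcol// (G_ext (y := pos e n)); last first.
    by move=> j; rewrite pos_swap_inner// /inner ap.
  by rewrite mulrN mulNr.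
rewrite (G_ext (y := pos e n \o pswap p)); last first.
  by move=> j; rewrite pos_swap_outer// /outer (negbTE ap).
rewrite G_alt ?lcol_neq_rcol// (F_ext (y := pos e 0)); last first.
  by move=> j; rewrite pos_swap_inner// /inner (negbTE ap).
by rewrite mulrN.
Qed.

(** Each class of arrays with a given tie as key is stable under the swap there, so its sum equals
    its own opposite. *)
Lemma sum_array_weight :
  \sum_e array_weight e = \sum_(e | tie_key e == None) array_weight e.
Proof.
rewrite (partition_big tie_key xpredT)//= (bigD1 None)//= [X in _ + X]big1 ?addr0//.
move=> [p _|//]; set s := (X in X = 0).
have : s = - s.
  rewrite {1}/s (reindex_inj (inv_inj (swapK p)))/= -sumrN.
  have keyE e : (tie_key (swap p e) == Some p) = (tie_key e == Some p).
    by apply/eqP/eqP => [/tie_key_swap|/tie_key_swap//]; rewrite swapK.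
  rewrite (eq_bigl _ _ keyE); apply: eq_bigr => e /eqP/tie_key_tie.
  exact: array_weight_swap.
by move/eqP; rewrite -addr_eq0 -mulr2n mulrn_eq0 => /eqP.
Qed.

End Cancellation.

Lemma pos_inj e e' : (forall m j, (m <= n)%N -> pos e m j = pos e' m j) -> e = e'.
Proof.
move=> ee'; apply/ffunP => j; apply/ffunP => r.
have := pos_step e r j; have := pos_step e' r j.
rewrite !ee' ?ltn_ord// 1?ltnW ?ltn_ord//.
by case: (e j r); case: (e' j r) => //; lia.
Qed.

Lemma array_of_rows (x : nat -> 'I_N -> nat) :
  (forall j, x (a j) j = l j) ->
  (forall (r : 'I_n) j, x r j = x r.+1 j \/ x r j = (x r.+1 j).+1) ->
  exists e, forall m j, (m <= n)%N -> pos e m j = x m j.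
Proof.
move=> xl x_step; exists [ffun j => [ffun r : 'I_n => x r j != x r.+1 j]] => m j.
set e := [ffun _ => _].
(* Both columns have the same increments, so their difference is constant; it vanishes at the
   anchor. *)
have diff_const i : (i <= n)%N -> pos e i j - (x i j)%:Z = pos e 0 j - (x 0%N j)%:Z.
  elim: i => [//|i IH lt_in]; rewrite -(IH (ltnW lt_in)).
  have := pos_step e (Ordinal lt_in) j; rewrite !ffunE/=.
  by have := x_step (Ordinal lt_in) j => /= -[] ->; case: eqP => h; lia.
move=> mn; have := diff_const _ mn; rewrite -(diff_const _ (a_le j)).
by rewrite pos_anchor xl; lia.
Qed.

End Arrays.

(** * Unordered sums *)

Section Summation.
Variable R : realType.

Definition has_sum (T : choiceType) (u : T -> R[i]) (l : R[i]) : Prop :=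
  (summability.partial_sum u : {fset T} -> R[i]^o) @ summability.totally --> (l : R[i]^o).

Lemma has_sumP (T : choiceType) (u : T -> R[i]) (l : R[i]) :
  has_sum u l <->
  forall e : R[i], 0 < e -> exists A0 : {fset T}, forall A : {fset T},
    (A0 `<=` A)%fset -> `|l - \sum_(x <- A) u x| < e.
Proof.
have totallyF : Filter (@summability.totally T) := summability.totally_filter.
split=> [ul e e0|ul].
  have [A0 _ A0P] := (@cvgrPdist_lt _ R[i]^o _ _ totallyF _ _).1 ul e e0.
  by exists A0 => A /A0P; rewrite /= /summability.partial_sum big_seq_fsetE.
apply/(@cvgrPdist_lt _ R[i]^o _ _ totallyF) => e e0; have [A0 A0P] := ul e e0.
exists A0; first by [].
by move=> A /A0P; rewrite /= /summability.partial_sum big_seq_fsetE.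
Qed.

Lemma csumE (T : choiceType) (u : T -> R[i]) (l : R[i]) :
  has_sum u l -> csum u = l.
Proof.
move=> ul; apply: (@cvg_lim R[i]^o _ _ _ (@summability.totally_filter T) _ _ ul).
exact: norm_hausdorff.
Qed.

Lemma has_sumD (T : choiceType) (u v : T -> R[i]) (k l : R[i]) :
  has_sum u k -> has_sum v l -> has_sum (fun x => u x + v x) (k + l).
Proof.
move=> uk vl; rewrite /has_sum.
have -> : summability.partial_sum (fun x => u x + v x) =
    (fun A => (summability.partial_sum u A : R[i]^o) + summability.partial_sum v A).
  by apply: boolp.funext => A; rewrite /summability.partial_sum big_split.
exact: (@cvgD _ R[i]^o _ _ summability.totally_filter _ _ _ _ uk vl).
Qed.

Lemma has_sumZ (T : choiceType) (u : T -> R[i]) (c l : R[i]) :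
  has_sum u l -> has_sum (fun x => c * u x) (c * l).
Proof.
move=> ul; rewrite /has_sum.
have -> : summability.partial_sum (fun x => c * u x) =
    (fun A => (c : R[i]^o) * (summability.partial_sum u A : R[i]^o)).
  by apply: boolp.funext => A; rewrite /summability.partial_sum mulr_sumr.
apply: (@cvgM _ _ _ summability.totally_filter _ _ _ _ _ ul).
exact: (@cvg_cst _ _ _ _ summability.totally_filter).
Qed.

Lemma ge0_bounded_has_sum (T : choiceType) (v : T -> R) (M : R) :
  (forall x, 0 <= v x) -> (forall A : {fset T}, \sum_(x <- A) v x <= M) ->
  exists l : R, has_sum (fun x => (v x)%:C%C) l%:C%C.
Proof.
move=> v0 vM; pose E := [set \sum_(x <- A) v x | A in [set: {fset T}]].
have supE : has_sup E.
  split; first by exists (\sum_(x <- fset0) v x), fset0.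
  by exists M => _ [A _ <-].
exists (sup E); apply/has_sumP => e e0.
have eRe : e = (complex.Re e)%:C%C by rewrite RRe_real// gtr0_real.
have Re0 : 0 < complex.Re e by move: e0; rewrite eRe ltcR.
have [_ [A0 _ <-] A0P] := sup_adherent Re0 supE.
exists A0 => A A0A.
rewrite -rmorph_sum -rmorphB eRe normc_def/= expr0n addr0 ltcR sqrtr_sqr.
have le1 : \sum_(x <- A) v x <= sup E by apply: sup_upper_bound => //; exists A.
have le2 : \sum_(x <- A0) v x <= \sum_(x <- A) v x.
  rewrite (big_fsetID _ (mem A0) A)/=.
  have -> : [fset x in A | x \in A0]%fset = A0.
    by apply/fsetP => x; rewrite !inE andb_idl// => /(fsubsetP A0A).
  by rewrite lerDl big_seq_fsetE sumr_ge0.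
by rewrite ger0_norm ?subr_ge0// ltrBlDr -ltrBlDl (lt_le_trans A0P).
Qed.

Lemma abs_summable_bounded (T : choiceType) (u : T -> R[i]) :
  abs_summable u -> exists M : R, forall A : {fset T},
    \sum_(x <- A) ComplexField.Normc.normc (u x) <= M.
Proof.
rewrite /abs_summable /summable.
set s := (\esum_(x in _) _)%E => sfin.
have s0 : (0 <= s)%E by apply: esum_ge0 => x _; exact: abse_ge0.
have sf : s \is a fin_num by rewrite ge0_fin_numE.
exists (fine s) => A; rewrite -lee_fin fineK// -sumEFin.
apply: esum_ge; exists [set` A]; first by split => //; exact: finite_fset.
rewrite fsbig_finite//= set_fsetK; apply: lee_sum => x _.
by rewrite lee_fin ler_norm.
Qed.

Lemma bounded_has_sum (T : choiceType) (u : T -> R[i]) (M : R) :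
  (forall A : {fset T}, \sum_(x <- A) ComplexField.Normc.normc (u x) <= M) ->
  exists l, has_sum u l.
Proof.
move=> uM.
have real_has_sum (v : T -> R) :
    (forall x, `|v x| <= ComplexField.Normc.normc (u x)) ->
    exists l : R, has_sum (fun x => (v x)%:C%C) l%:C%C.
  move=> vu.
  (* A real family is the difference of |v| + v and |v|, both nonnegative with bounded partial
     sums. *)
  have [||k kP] := @ge0_bounded_has_sum _ (fun x => `|v x| + v x) (M + M).
  - by move=> x; rewrite -lerBlDr sub0r -normrN ler_norm.
  - move=> A; rewrite big_split/= lerD// (le_trans _ (uM A))// ler_sum//.
    by move=> x _; rewrite (le_trans _ (vu x))// ler_norm.
  have [||k' kP'] := @ge0_bounded_has_sum _ (fun x => `|v x|) M.
  - by [].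
  - by move=> A; rewrite (le_trans _ (uM A))// ler_sum.
  exists (k - k').
  have := has_sumD kP (@has_sumZ _ _ (-1) _ kP').
  rewrite mulN1r -rmorphB.
  congr has_sum; apply: boolp.funext => x.
  by rewrite mulN1r -rmorphB addrAC subrr add0r.
have normE x : (ComplexField.Normc.normc x)%:C%C = `|x| :> R[i] by [].
have [|l lP] := real_has_sum (fun x => complex.Re (u x)).
  by move=> x; rewrite -lecR normE normc_ge_Re.
have [|k kP] := real_has_sum (fun x => complex.Im (u x)).
  move=> x; rewrite -lecR normE -[leRHS]mulr1.
  have <- : `|'i%C| = 1 :> R[i].
    by rewrite normc_def/= expr0n add0r expr1n sqrtr1.
  by rewrite -normrM -(normrN (complex.Im _)) -ReiNIm normc_ge_Re.
exists (l%:C%C + 'i%C * k%:C%C); have := has_sumD lP (@has_sumZ _ _ 'i%C _ kP).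
by congr has_sum; apply: boolp.funext => x; rewrite -complexE.
Qed.

Lemma abs_summable_has_sum (T : choiceType) (u : T -> R[i]) :
  abs_summable u -> exists l, has_sum u l.
Proof. by move=> /abs_summable_bounded[M]; exact: bounded_has_sum. Qed.

(** [g] reaches every point of the support of [u] and none twice. The fibers being finite, a finite
    sum over [S] is a finite partial sum of [u]. *)
Lemma has_sum_fibers (S T : choiceType) (E : finType) (P : S -> pred E)
    (g : S -> E -> T) (u : T -> R[i]) (l : R[i]) :
  (forall s s' e e', P s e -> P s' e' -> g s e = g s' e' -> s = s' /\ e = e') ->
  (forall t, u t != 0 -> exists s, exists2 e, P s e & g s e = t) ->
  has_sum u l -> has_sum (fun s => \sum_(e | P s e) u (g s e)) l.
Proof.
move=> g_inj g_cover /has_sumP ul; apply/has_sumP => eps eps0.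
have [A0 A0P] := ul eps eps0.
have [B0 B0P] : exists B0 : {fset S}, forall t, t \in enum_fset A0 -> u t != 0 ->
    exists2 s, s \in B0 & exists2 e, P s e & g s e = t.
  elim: (enum_fset A0) => [|t A [B BP]]; first by exists fset0.
  have [ut0|/g_cover[s sP]] := eqVneq (u t) 0.
    exists B => t'; rewrite inE => /predU1P[->|]; last exact: BP.
    by rewrite ut0 eqxx.
  exists (s |` B)%fset => t'; rewrite inE => /predU1P[->|t'A].
    by exists s => //; rewrite !inE eqxx.
  by move=> /(BP _ t'A)[s' s'B]; exists s' => //; rewrite !inE s'B orbT.
exists B0 => B /fsubsetP B0B.
pose I : seq T := [seq g s e | s <- enum_fset B, e <- enum (P s)].
have I_uniq : uniq I.
  apply: allpairs_uniq_dep => [|s _|]; [exact: fset_uniq|exact: enum_uniq|].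
  move=> [s e] [s' e'] /allpairsPdep[s1 [e1 [_ Pe1 [-> ->]]]].
  move=> /allpairsPdep[s2 [e2 [_ Pe2 [-> ->]]]] /=.
  rewrite !mem_enum in Pe1 Pe2.
  by move=> /(g_inj _ _ _ _ Pe1 Pe2)[-> ->].
(* The points of [A0] outside [I] are zeros of [u]: adding them does not change the sum and makes
   [A] contain [A0]. *)
pose A := (A0 `|` [fset x in I])%fset.
suff -> : \sum_(s <- B) \sum_(e | P s e) u (g s e) = \sum_(t <- A) u t.
  by apply: A0P; exact: fsubsetUl.
rewrite -(@big_fset_incl _ _ _ _ [fset x in I]%fset) ?fsubsetUr//=; last first.
  move=> t; rewrite !inE => /orP[tA0|->//] tI.
  apply: contraTeq isT => /(B0P _ tA0)[s sB [e Pe gt]].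
  case/negP: tI; rewrite -gt; apply: allpairs_f_dep; first exact: B0B.
  by rewrite mem_enum.
rewrite [RHS](perm_big I)/=; last first.
  by apply: uniq_perm => [|//|t]; rewrite ?fset_uniq// !inE.
rewrite big_allpairs_dep/=; apply: eq_bigr => s _.
by rewrite big_enum.
Qed.

Lemma has_sum_cvg (T : choiceType) (u : T -> R[i]) (l : R[i])
    (A : nat -> {fset T}) :
  (forall B, \forall k \near \oo, (B `<=` A k)%fset) -> has_sum u l ->
  (\sum_(x <- A k) u x : R[i]^o) @[k --> \oo] --> (l : R[i]^o).
Proof.
move=> Aoo /has_sumP ul; apply/cvgrPdist_lt => e e0.
have [A0 A0P] := ul e e0.
by apply: filterS (Aoo A0) => k; exact: A0P.
Qed.

End Summation.

(** * Marginals of the two-dimensional ensemble *)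

Section Ensembles.
Variables (R : realType) (n : nat).
Local Notation N := n.+1.
Local Notation C := R[i].
Local Notation array := {ffun 'I_N -> {ffun 'I_n -> bool}}.

Lemma conf_dec m (X : conf m) (i j : 'I_m) : (i < j)%N -> (X j < X i)%N.
Proof. by move=> ij; have /forallP/(_ i)/forallP/(_ j)/implyP/(_ ij) := valP X. Qed.

Lemma conf_of_dec m (x : {ffun 'I_m -> nat}) :
  (forall i j : 'I_m, (i < j)%N -> (x j < x i)%N) -> exists X : conf m, x = X.
Proof.
move=> xP; have xb : [forall i : 'I_m, forall j : 'I_m, (i < j)%N ==> (x j < x i)%N].
  by apply/forallP => i; apply/forallP => j; exact/implyP/xP.
by exists (exist _ x xb).
Qed.

Lemma conf_inj m : injective (@conf_pos m).
Proof. exact: val_inj. Qed.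

Lemma Tker_neq0 (b : C) x y : Tker b x y != 0 -> y = x \/ y.+1 = x.
Proof.
rewrite /Tker; have [->|_] := eqVneq y x; first by left.
have [->|_] := eqVneq y.+1 x; first by right.
by rewrite mulr0 subr0 eqxx.
Qed.

(** In a nonzero term, [y (s k)] is [x k] or [x k - 1]. As [x] decreases strictly, [y (s j)] cannot
    exceed [y (s i)] for [i < j], so [s] is increasing, hence the identity. *)
Lemma det_Tker (b : C) m (x y : conf m) :
  \det (\matrix_(i < m, j < m) Tker b (x i) (y j)) = \prod_(j < m) Tker b (x j) (y j).
Proof.
rewrite /determinant (bigD1 1%g)//= [X in _ + X]big1 ?addr0; last first.
  move=> s s1; apply/eqP; rewrite mulf_eq0 signr_eq0/=.
  apply: contraR s1 => /prodf_neq0 Ts; apply/eqP/increasing_perm1 => i j ij.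
  have yx k : y (s k) = x k \/ (y (s k)).+1 = x k.
    by apply: (@Tker_neq0 b); have := Ts k isT; rewrite mxE.
  have xij := conf_dec x ij.
  have s_neq : s i != s j.
    by rewrite (inj_eq perm_inj); apply: contraTneq ij => ->; rewrite ltnn.
  have : s i != s j :> nat by [].
  rewrite neq_ltn => /orP[//|/(conf_dec y)].
  by case: (yx i); case: (yx j); lia.
by rewrite odd_perm1 mul1r; apply: eq_bigr => j _; rewrite mxE perm1.
Qed.

(* The extension by zero to negative arguments turns [Ddag] into a shift operator
   without boundary term. *)
Definition zext (f : nat -> C) (k : int) : C := if k is Posz m then f m else 0.

Variables (Phi Psi : 'I_N -> nat -> C) (beta : 'I_n -> C).

Section Anchored.
Variable a : 'I_N -> nat.
Hypothesis a_le : forall j, (a j <= n)%N.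
Hypothesis a_mono : forall i j : 'I_N, (i <= j)%N -> (a i <= a j)%N.
Hypothesis a_step : forall k : 'I_n, (a (rcol k) <= (a (lcol k)).+1)%N.

(* The weight of the marginal on the entries (x^{a 0}_0, ..., x^{a n}_n): [a j = j]
   gives [weight1d], [a j = n] gives the law of the last row. *)
Definition anchored_weight (X : conf N) : C :=
  \det (\matrix_(i < N, j < N) Dint beta 0 (a j) (Phi i) (X j)) *
  \det (\matrix_(i < N, j < N) Ddagint beta (a j) n (Psi i) (X j)).

Definition anchors (X : conf2d N) : {ffun 'I_N -> nat} :=
  [ffun j => X (inord (a j)) j].

Definition det_zext (f : 'I_N -> nat -> C) (x : 'I_N -> int) : C :=
  \det (\matrix_(i < N, j < N) zext (f i) (x j)).

Lemma det_zext_ext f (x y : 'I_N -> int) : x =1 y -> det_zext f x = det_zext f y.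
Proof. by move=> /boolp.funext ->. Qed.

Lemma det_zext_alt f (x : 'I_N -> int) i j : i != j ->
  det_zext f (x \o tperm i j) = - det_zext f x.
Proof.
move=> ij; rewrite /det_zext (det_comp_perm (fun i => zext (f i)) x (tperm i j)).
by rewrite odd_tperm ij mulN1r.
Qed.

Local Notation weight X :=
  (array_weight a X (fun r => - beta r) (det_zext Phi) (det_zext Psi)).

(** The columns are independent. In column [j], the steps before row [a j] raise row 0 and yield D
    acting on [Phi]; the later ones lower row [n] and yield the adjoint acting on [Psi]. *)
Lemma sum_weight (X : conf N) : \sum_(e : array) weight X e = anchored_weight X.
Proof.
pose b (_ : 'I_N) (e : {ffun 'I_n -> bool}) := \prod_r (- beta r) ^+ e r.
pose f (h : 'I_N -> nat -> C) (u : nat) i j (e : {ffun 'I_n -> bool}) :=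
  zext (h i) ((X j)%:Z + \sum_(r < n) (e r)%:Z * ((u <= r)%N%:Z - (a j <= r)%N%:Z)).
rewrite [LHS](sum_prod_det_det (f Phi 0%N) (f Psi n) b).
rewrite /anchored_weight !det_columns big_distrlr; apply: eq_bigr => s _.
apply: eq_bigr => t _; rewrite /= [RHS]mulrACA; congr (_ * _); rewrite -big_split.
apply: eq_bigr => j _ /=.
have upE (e : {ffun 'I_n -> bool}) :
    \sum_(r < n) (e r)%:Z * ((0 <= r)%N%:Z - (a j <= r)%N%:Z) =
    \sum_(r < n | (r < a j)%N) (e r)%:Z.
  by rewrite [RHS]big_mkcond; apply: eq_bigr => r _; case: ltnP; lia.
have downE (e : {ffun 'I_n -> bool}) :
    \sum_(r < n) (e r)%:Z * ((n <= r)%N%:Z - (a j <= r)%N%:Z) =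
    - \sum_(r < n | ~~ (r < a j)%N) (e r)%:Z.
  rewrite [in RHS]big_mkcond -sumrN; apply: eq_bigr => r _.
  by rewrite [(n <= r)%N]leqNgt ltn_ord/=; case: (ltnP r (a j)) => _; case: (e r).
under eq_bigr => e _ do rewrite /f upE downE.
rewrite (shift_ops_expand (fun r : 'I_n => (r < a j)%N)).
rewrite (shift_ops_up_ge0 _ (op := fun r => Dop (beta r)) (f := Phi (s j)))//; last first.
  by move=> r g k; rewrite /Dop mulNr.
rewrite (shift_ops_down_ge0 _ (op := fun r => Ddag (beta r)) (f := Psi (t j)))//;
  last 2 first.
- by move=> r g k; rewrite /Ddag !mulNr.
- by case.
have -> // : Ddagint beta (a j) n = \big[(fun F G => F \o G)/id]_(r < n |
    predC (fun r : 'I_n => (r < a j)%N) r) Ddag (beta r).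
by apply: eq_bigl => r; rewrite /= ltn_ord andbT leqNgt.
Qed.

(* The default value X of [insubd] is not reached for good arrays. *)
Definition conf2d_of_array (X : conf N) (e : array) : conf2d N :=
  [ffun m : 'I_N => insubd X [ffun j => `|pos a X e m j|%N]].

Definition good_array (X : conf N) (e : array) : bool :=
  (tie_key a X e == None) && [forall m : 'I_N, forall j, 0 <= pos a X e m j].

Lemma conf2d_of_arrayE (X : conf N) e (m j : 'I_N) : good_array X e ->
  (conf2d_of_array X e m j)%:Z = pos a X e m j.
Proof.
move=> /andP[/eqP no_tie /forallP pos_ge0].
have posE k : `|pos a X e m k|%N%:Z = pos a X e m k.
  by rewrite gez0_abs//; have /forallP/(_ k) := pos_ge0 m.
rewrite ffunE -[conf_pos _]/(val _) val_insubd ifT; first by rewrite ffunE posE.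
apply/forallP => i; apply/forallP => k; apply/implyP => ik; rewrite !ffunE.
rewrite -ltz_nat !posE; apply: no_tie_dec ik => //; last by rewrite -ltnS.
- by move=> *; exact: conf_dec.
- exact: tie_key_none.
Qed.

Lemma anchors_conf2d_of_array (X : conf N) e : good_array X e ->
  anchors (conf2d_of_array X e) = X.
Proof.
move=> eP; apply/ffunP => j; rewrite ffunE; apply/eqP; rewrite -eqz_nat.
by rewrite conf2d_of_arrayE// inordK ?ltnS// pos_anchor.
Qed.

Lemma weight2d_conf2d_of_array (X : conf N) e : good_array X e ->
  weight2d Phi Psi beta (conf2d_of_array X e) = weight X e.
Proof.
move=> eP; rewrite /weight2d /array_weight.
have zextE f (m : 'I_N) :
    \det (\matrix_(i < N, j < N) f i (conf2d_of_array X e m j)) =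
    det_zext f (pos a X e m).
  by congr (\det _); apply/matrixP => i j; rewrite !mxE -conf2d_of_arrayE.
rewrite !zextE; congr (_ * _); rewrite mulrC; congr (_ * _).
rewrite exchange_big/=; apply: eq_bigr => r _; rewrite det_Tker.
apply: eq_bigr => j _; have := pos_step a X e r j.
have -> : pos a X e r j = (conf2d_of_array X e (widen_ord (leqnSn n) r) j)%:Z.
  by rewrite conf2d_of_arrayE.
have -> : pos a X e r.+1 j = (conf2d_of_array X e (lift ord0 r) j)%:Z.
  by rewrite conf2d_of_arrayE.
move: (conf2d_of_array _ _ _ _) (conf2d_of_array _ _ _ _) => x y.
(* The kernel is 1 on a step of 0 and [- beta r] on a step of 1. *)
rewrite /Tker -PoszD => -[->]; case: (e j r).
  by rewrite addn1 eqxx ltn_eqF// mulr1 sub0r expr1.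
by rewrite addn0 eqxx gtn_eqF// mulr0 subr0 expr0.
Qed.

Lemma sum_good_weight (X : conf N) :
  \sum_(e | good_array X e) weight2d Phi Psi beta (conf2d_of_array X e) =
  anchored_weight X.
Proof.
under eq_bigr => e eP do rewrite weight2d_conf2d_of_array//.
rewrite -sum_weight sum_array_weight//; last 4 first.
- exact: det_zext_ext.
- exact: det_zext_ext.
- exact: det_zext_alt.
- exact: det_zext_alt.
rewrite [RHS](bigID (fun e => [forall m : 'I_N, forall j, 0 <= pos a X e m j]))/=.
rewrite [X in _ = _ + X]big1 ?addr0// => e /andP[_].
rewrite negb_forall => /existsP[m]; rewrite negb_forall => /existsP[j].
rewrite -ltNge => pos_lt0; rewrite /array_weight.
(* Columns go weakly down, so a negative entry persists to row [n], where it gives a zero column in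
   the determinant of [Psi]. *)
have pos_decr i : (m + i <= n)%N -> pos a X e (m + i)%N j < 0.
  elim: i => [|i IH]; first by rewrite addn0.
  rewrite addnS => lt_in; have := pos_step a X e (Ordinal lt_in) j => /=.
  have := IH (ltnW lt_in); case: (e j _) => /=; lia.
have : pos a X e n j < 0.
  have le_mn : (m <= n)%N by rewrite -ltnS.
  by have := pos_decr (n - m)%N; rewrite subnKC// => /(_ (leqnn n)).
move=> pos_n_lt0; rewrite /det_zext -[X in _ * X]det_tr [X in _ * X](expand_det_row _ j).
rewrite [X in _ * X]big1 ?mulr0// => i _; rewrite !mxE.
by move: pos_n_lt0; case: (pos a X e n j) => // k _; rewrite mul0r.
Qed.

(** The good arrays over all [X] give each configuration at most once and include all those of
    nonzero weight, so the sum can be taken over the fibers of [anchors]. *)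
Lemma has_sum_anchors (f : {ffun 'I_N -> nat} -> C) (s : C) :
  has_sum (fun X : conf2d N => f (anchors X) * weight2d Phi Psi beta X) s ->
  has_sum (fun X : conf N => f X * anchored_weight X) s.
Proof.
move=> /(has_sum_fibers (P := good_array) (g := conf2d_of_array)).
have -> : (fun X : conf N => f X * anchored_weight X) =
   (fun X => \sum_(e | good_array X e) f (anchors (conf2d_of_array X e)) *
        weight2d Phi Psi beta (conf2d_of_array X e)).
  apply: boolp.funext => X; rewrite -sum_good_weight mulr_sumr.
  by apply: eq_bigr => e eP; rewrite anchors_conf2d_of_array.
apply.
  move=> X X' e e' eP eP' XX'.
  have XE : X = X'.
    apply: conf_inj.
    by rewrite -(anchors_conf2d_of_array eP) XX' anchors_conf2d_of_array.
  split=> //; rewrite -{}XE in eP' XX'.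
  apply: (pos_inj (a := a) (l := conf_pos X)) => m j mn.
  have := conf2d_of_arrayE (inord m) j eP.
  have := conf2d_of_arrayE (inord m) j eP'.
  by rewrite XX' inordK// => <- <-.
move=> t; rewrite mulf_eq0 negb_or => /andP[_].
rewrite /weight2d !mulf_eq0 !negb_or => /andP[/andP[_ /prodf_neq0 Ts] _].
have t_step (r : 'I_n) j :
    t (inord r) j = t (inord r.+1) j \/ t (inord r) j = (t (inord r.+1) j).+1.
  have := Ts r isT; rewrite det_Tker => /prodf_neq0/(_ j isT)/Tker_neq0.
  have -> : widen_ord (leqnSn n) r = inord r.
    by apply: val_inj; rewrite /= inordK// ltnW// ltnS.
  have -> : lift ord0 r = inord r.+1 by apply: val_inj; rewrite /= inordK// ltnS.
  by case=> ->; [left|right].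
have t_decr j m m' : (m <= m' <= n)%N -> (t (inord m') j <= t (inord m) j)%N.
  elim: m' => [|m' IH]; first by case: m.
  rewrite leq_eqVlt => /andP[/predU1P[->//|lt_mm'] lt_m'n].
  have := IH; rewrite -ltnS lt_mm' ltnW// => /(_ isT).
  by have := t_step (Ordinal lt_m'n) j => /= -[] ->; lia.
have [X tX] : exists X : conf N, anchors t = X.
  apply: conf_of_dec => i j ij; rewrite !ffunE.
  (* Column [j] goes weakly down from row [a i] to row [a j], and row [a i] is strictly
     decreasing. *)
  apply: (leq_ltn_trans (t_decr _ _ _ _) (conf_dec _ ij)).
  by rewrite a_mono//= ltnW.
have [|//|e posE] := @array_of_rows n a X a_le (fun m => t (inord m)).
  by move=> j; rewrite -tX ffunE.
have le_mn (m : 'I_N) : (m <= n)%N by rewrite -ltnS.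
have eP : good_array X e.
  apply/andP; split; last first.
    by apply/forallP => m; apply/forallP => j; rewrite posE// -ltnS.
  case E : (tie_key a X e) => [[m k]|//].
  have := tie_key_tie E; rewrite /tie/= !posE// => /eqP[tE].
  have := conf_dec (t (inord m)) (i := lcol k) (j := rcol k) (ltnSn k).
  by rewrite tE ltnn.
exists X, e => //; apply/ffunP => m; apply: conf_inj; apply/ffunP => j.
apply/eqP; rewrite -eqz_nat conf2d_of_arrayE// posE//.
by rewrite inord_val.
Qed.

End Anchored.
End Ensembles.

(** * Infinite Cauchy-Binet formula *)

Section DetLimit.
Variable R : realType.
Local Notation C := R[i].

Lemma cvg_sum_seq (I : Type) (r : seq I) (F : I -> nat -> C) (f : I -> C) :
  (forall i, (F i k : C^o) @[k --> \oo] --> (f i : C^o)) ->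
  (\sum_(i <- r) F i k : C^o) @[k --> \oo] --> (\sum_(i <- r) f i : C^o).
Proof.
move=> Ff; elim: r => [|i r IH].
  under boolp.eq_fun => k do rewrite big_nil.
  by rewrite big_nil; exact: cvg_cst.
under boolp.eq_fun => k do rewrite big_cons.
by rewrite big_cons; exact: (@cvgD _ C^o _ _ _ _ _ _ _ (Ff i) IH).
Qed.

Lemma cvg_prod_seq (I : Type) (r : seq I) (F : I -> nat -> C) (f : I -> C) :
  (forall i, (F i k : C^o) @[k --> \oo] --> (f i : C^o)) ->
  (\prod_(i <- r) F i k : C^o) @[k --> \oo] --> (\prod_(i <- r) f i : C^o).
Proof.
move=> Ff; elim: r => [|i r IH].
  under boolp.eq_fun => k do rewrite big_nil.
  by rewrite big_nil; exact: cvg_cst.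
under boolp.eq_fun => k do rewrite big_cons.
by rewrite big_cons; exact: (@cvgM _ _ _ _ _ _ _ _ (Ff i) IH).
Qed.

Lemma cvg_det (m : nat) (F : 'I_m -> 'I_m -> nat -> C) (M : 'M[C]_m) :
  (forall i j, (F i j k : C^o) @[k --> \oo] --> (M i j : C^o)) ->
  (\det (\matrix_(i, j) F i j k) : C^o) @[k --> \oo] --> (\det M : C^o).
Proof.
move=> FM; rewrite /determinant.
apply: (@cvg_sum_seq _ _ (fun (s : 'S_m) k => (-1) ^+ s *
   \prod_i (\matrix_(i, j) F i j k) i (s i))
  (fun s : 'S_m => (-1) ^+ s * \prod_i M i (s i))).
move=> s; apply: (@cvgM _ _ _ _ _ _ _ _ (@cvg_cst _ _ _ _ _)).
apply: (@cvg_prod_seq _ _ (fun i k => (\matrix_(i, j) F i j k) i (s i))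
  (fun i => M i (s i))) => i.
by under boolp.eq_fun => k do rewrite mxE; exact: FM.
Qed.

End DetLimit.

Section InfiniteCauchyBinet.
Variables (R : realType) (m : nat).
Local Notation C := R[i].

Lemma conf_inhabited : inhabited (conf m).
Proof.
have [|X _] := @conf_of_dec m [ffun i : 'I_m => (m - i)%N]; last exact: inhabits.
by move=> i j ij; rewrite !ffunE; have := ltn_ord j; lia.
Qed.

Definition conf_of_ord K (y : {ffun 'I_m -> 'I_K}) : conf m :=
  insubd (inhabited_witness conf_inhabited) [ffun i => nat_of_ord (y i)].

Lemma conf_of_ordE K (y : {ffun 'I_m -> 'I_K}) i :
  strict_dec y -> conf_of_ord y i = y i.
Proof.
move=> /strict_decP yP; rewrite -[conf_pos _]/(val _) val_insubd ifT ?ffunE//.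
by apply/'forall_'forall_implyP => j k jk; rewrite !ffunE yP.
Qed.

Definition confs_below K : {fset conf m} :=
  [fset conf_of_ord y | y in [pred y : {ffun 'I_m -> 'I_K} | strict_dec y]]%fset.

Lemma confs_below_cofinal (B : {fset conf m}) :
  \forall K \near \oo, (B `<=` confs_below K)%fset.
Proof.
pose top (X : conf m) := \max_i (X i).+1.
exists (\max_(X <- B) top X) => // K /= le_K0K; apply/fsubsetP => X XB.
have ltXK i : (conf_pos X i < K)%N.
  apply: leq_trans le_K0K; apply: (@leq_trans (top X)); last exact: leq_bigmax_seq.
  exact: (@leq_bigmax _ (fun i => (conf_pos X i).+1)).
have yP : strict_dec [ffun i => Ordinal (ltXK i)].
  by apply/strict_decP => i j ij; rewrite !ffunE/= conf_dec.
apply/imfsetP; exists [ffun i => Ordinal (ltXK i)] => //.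
by apply: conf_inj; apply/ffunP => i; rewrite conf_of_ordE// ffunE.
Qed.

Lemma sum_confs_below K (v : conf m -> C) :
  \sum_(X <- confs_below K) v X =
  \sum_(y : {ffun 'I_m -> 'I_K} | strict_dec y) v (conf_of_ord y).
Proof.
rewrite big_imfset/=; first by rewrite big_enum.
move=> y y' yP y'P yy'; apply/ffunP => i; apply: val_inj.
by rewrite /= -(conf_of_ordE i yP) -(conf_of_ordE i y'P) yy'.
Qed.

(** Along the exhausting sets [confs_below K], the partial sums are determinants of truncated
    series, by the finite formula; continuity of the determinant gives the limit. *)
Lemma has_sum_Cauchy_Binet (A B : 'I_m -> nat -> C) (M : 'M[C]_m) (s : C) :
  (forall i j, (\sum_(k < K) A i k * B j k : C^o) @[K --> \oo] --> (M i j : C^o)) ->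
  has_sum (fun X : conf m =>
    \det (\matrix_(i < m, j < m) A i (X j)) *
    \det (\matrix_(i < m, j < m) B i (X j))) s ->
  s = \det M.
Proof.
move=> ABM /(has_sum_cvg confs_below_cofinal).
under boolp.eq_fun => K do rewrite sum_confs_below.
move=> sumE.
have detE K : \sum_(y : {ffun 'I_m -> 'I_K} | strict_dec y)
    \det (\matrix_(i < m, j < m) A i (conf_of_ord y j)) *
    \det (\matrix_(i < m, j < m) B i (conf_of_ord y j)) =
    \det (\matrix_(i, j) \sum_(k < K) A i k * B j k).
  rewrite -(Cauchy_Binet (fun i (k : 'I_K) => A i k) (fun i (k : 'I_K) => B i k)).
  apply: eq_bigr => y yP; congr (_ * _); congr (\det _);
    by apply/matrixP => i j; rewrite !mxE conf_of_ordE.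
move: sumE; under boolp.eq_fun => K do rewrite detE.
move=> sumE.
have lim1 := cvg_lim (@norm_hausdorff _ C^o) sumE.
have lim2 := cvg_lim (@norm_hausdorff _ C^o) (cvg_det ABM).
by rewrite -lim1 -lim2.
Qed.

End InfiniteCauchyBinet.

(** Initial segments are cofinal among the finite subsets of [nat], so the series converges to the
    unordered sum. *)
Lemma abs_summable_series (R : realType) (u : nat -> R[i]) : abs_summable u ->
  (\sum_(k < K) u k : R[i]^o) @[K --> \oo] -->
  (limn (series (u : nat -> R[i]^o)) : R[i]^o).
Proof.
move=> /abs_summable_has_sum[l ul].
pose A K := [fset k in iota 0 K]%fset.
have Aoo (B : {fset nat}) : \forall K \near \oo, (B `<=` A K)%fset.
  exists (\max_(k <- B) k.+1) => // K /= le_K; apply/fsubsetP => k kB.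
  rewrite !inE mem_iota/= add0n; apply: leq_trans le_K.
  exact: (leq_bigmax_seq (F := succn)).
have := has_sum_cvg Aoo ul.
have -> : (fun K => \sum_(k <- A K) u k) = (fun K => \sum_(k < K) u k).
  apply: boolp.funext => K; rewrite -(big_mkord xpredT u) (perm_big (iota 0 K))/=.
    by rewrite /index_iota subn0.
  by apply: uniq_perm => [||k]; rewrite ?fset_uniq ?iota_uniq// !inE.
move=> cvgu.
have seriesE : series (u : nat -> R[i]^o) = (fun K => \sum_(k < K) u k).
  by apply: boolp.funext => K; rewrite /series/= big_mkord.
by rewrite seriesE (cvg_lim (@norm_hausdorff _ R[i]^o) cvgu).
Qed.

(** * Comparison of the normalizing constants and of the marginals *)

Theorem theorem2p3 (R : realType) (n : nat)
  (Phi Psi : 'I_n.+1 -> nat -> R[i]) (beta : 'I_n -> R[i])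
  (summable_G : forall i j : 'I_n.+1, abs_summable (Gterm Phi Psi beta i j))
  (summable_1d : abs_summable (weight1d Phi Psi beta))
  (summable_2d : abs_summable (weight2d Phi Psi beta))
  (Z1d_neq0 : Z1d Phi Psi beta <> 0) :
  [/\ Z2d Phi Psi beta = Z1d Phi Psi beta,
      Z1d Phi Psi beta = \det (Gmx Phi Psi beta)
    & forall f : {ffun 'I_n.+1 -> nat} -> R[i],
        finite_set [set v | f v <> 0] ->
        csum (fun X : conf2d n.+1 => f (diag2d X) * M2d Phi Psi beta X) =
        csum (fun X : conf n.+1 => f X * M1d Phi Psi beta X)].
Proof.
pose diag (j : 'I_n.+1) := nat_of_ord j.
have diag_le j : (diag j <= n)%N by rewrite /diag -ltnS.
have diag_step (k : 'I_n) : (diag (rcol k) <= (diag (lcol k)).+1)%N by [].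
have anchors_diag (X : conf2d n.+1) : anchors diag X = diag2d X.
  by apply/ffunP => j; rewrite !ffunE inord_val.
have marginal (f : {ffun 'I_n.+1 -> nat} -> R[i]) s :
    has_sum (fun X : conf2d n.+1 => f (diag2d X) * weight2d Phi Psi beta X) s ->
    has_sum (fun X : conf n.+1 => f X * weight1d Phi Psi beta X) s.
  move=> fs; apply: (has_sum_anchors diag_le (fun _ _ => id) diag_step).
  by under boolp.eq_fun => X do rewrite anchors_diag.
have [Z ZP] := abs_summable_has_sum summable_2d.
have Z1P : has_sum (weight1d Phi Psi beta) Z.
  have := marginal (fun=> 1) Z.
  under boolp.eq_fun => X do rewrite mul1r.
  under [X in _ -> has_sum X _]boolp.eq_fun => X do rewrite mul1r.
  exact.
rewrite /Z2d /Z1d (csumE ZP) (csumE Z1P); split=> //.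
  (* With all anchors in row [n] the adjoint operators disappear, and Cauchy-Binet evaluates the
     same total [Z]. *)
  pose last_row (_ : 'I_n.+1) := n.
  have := @has_sum_anchors _ _ Phi Psi beta last_row (fun=> leqnn n)
    (fun _ _ _ => leqnn n) (fun=> leqnSn n) (fun=> 1) Z.
  under boolp.eq_fun => X do rewrite mul1r.
  under [X in _ -> has_sum X _]boolp.eq_fun => X do rewrite mul1r.
  move=> /(_ ZP).
  have DdagE i : Ddagint beta n n (Psi i) = Psi i.
    rewrite /Ddagint big_pred0// => r; lia.
  rewrite /anchored_weight/=.
  apply: (has_sum_Cauchy_Binet (A := fun i => Dint beta 0 n (Phi i))
    (B := fun i => Ddagint beta n n (Psi i))).
  move=> i j; rewrite mxE DdagE.
  have := abs_summable_series (summable_G i j).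
  set S := (X in X @ _ --> _ -> _); set S' := (X in _ -> X @ _ --> _).
  suff -> : S = S' by [].
  by apply: boolp.funext => K; apply: eq_bigr => k _; rewrite /Gterm mulrC.
move=> f f_fin.
pose S := fset_set [set v | f v <> 0].
have normc_ge0 (z : R[i]) : 0 <= ComplexField.Normc.normc z.
  by case: z => x y; exact: sqrtr_ge0.
(* The sum of the moduli over the finite support bounds [f], so the two-dimensional sum weighted by
   [f] exists. *)
pose b : R := \sum_(v <- S) ComplexField.Normc.normc (f v).
have fb v : ComplexField.Normc.normc (f v) <= b.
  have [->|/eqP fv] := eqVneq (f v) 0.
    by rewrite ComplexField.Normc.normc0 sumr_ge0// => w _; exact: normc_ge0.
  rewrite /b (big_fsetD1 v)/=; last by rewrite in_fset_set//; exact: mem_set.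
  by rewrite lerDl sumr_ge0// => w _; exact: normc_ge0.
have [M wM] := abs_summable_bounded summable_2d.
have [s sP] : exists s, has_sum (fun X => f (diag2d X) * weight2d Phi Psi beta X) s.
  apply: (@bounded_has_sum _ _ _ (b * M)) => A.
  apply: (@le_trans _ _ (b *
    \sum_(X <- A) ComplexField.Normc.normc (weight2d Phi Psi beta X))).
    rewrite mulr_sumr ler_sum// => X _; rewrite ComplexField.Normc.normcM.
    by rewrite ler_wpM2r ?fb// normc_ge0.
  by rewrite ler_wpM2l// (le_trans _ (fb [ffun=> 0%N]))// normc_ge0.
have normalize (T : choiceType) (u v : T -> R[i]) :
    has_sum (fun x => u x * v x) s -> csum (fun x => u x * (v x / Z)) = s / Z.
  move=> /(@has_sumZ _ _ _ Z^-1)/csumE; rewrite mulrC => <-; congr csum.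
  by apply: boolp.funext => x; rewrite mulrA mulrC.
rewrite /M2d /M1d /Z1d (csumE Z1P).
by rewrite (normalize _ _ _ sP) (normalize _ _ _ (marginal _ _ sP)).
Qed.
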